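(* Let $x,y\geqslant 3$ be real numbers and let $\lambda$ be a real number with $$ 3 \leqslant \lambda\leqslant \frac{\log y}{(\log \log y)^2}, $$ and suppose that $$ \exp\left(20\lambda \,\log(\lambda\log \log x)\, \log \log x\right)\leqslant y\leqslant x. $$ Then, for all but at most $O(x^{0.49})$ natural numbers $q \leqslant x$, we have $$ \max_{\chi \in \mathcal{X}_q^*} \left|\sum_{1 \leqslant a \leqslant y} \chi(a)\right|\ll \frac{y}{(\log y)^{\lambda\log 2-1}}, $$ where the implied constants (both in $O(x^{0.49})$ and in $\ll$) are absolute; in particular they do not depend on $\lambda$.
   Context: $\mathcal{X}_q^*$ denotes the set of all primitive Dirichlet characters modulo $q$; the sum runs over integers $a$ with $1\leqslant a\leqslant y$. $U\ll V$ and $U=O(V)$ mean $|U|\leqslant cV$ for an absolute constant $c>0$. *)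

(* Defs.v *)
From Stdlib Require Import Reals Lra Lia Arith.
From Coquelicot Require Import Coquelicot.
Open Scope R_scope.

Definition dirichlet_char (q : nat) (chi : nat -> C) : Prop :=
  (forall m n : nat, chi (m * n)%nat = Cmult (chi m) (chi n)) /\
  (forall n : nat, chi (n + q)%nat = chi n) /\
  (forall n : nat, chi n = 0%C <-> Nat.gcd n q <> 1%nat) /\
  chi 1%nat = 1%C.

Definition induced_modulus (q d : nat) (chi : nat -> C) : Prop :=
  forall n : nat, Nat.gcd n q = 1%nat -> Nat.modulo n d = Nat.modulo 1 d -> chi n = 1%C.

Definition primitive_char (q : nat) (chi : nat -> C) : Prop :=
  dirichlet_char q chi /\
  forall d : nat, Nat.divide d q -> (d < q)%nat -> ~ induced_modulus q d chi.

Definition charsum (chi : nat -> C) (y : R) : C :=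
  sum_n_m chi 1 (Z.to_nat (Int_part y)).

(* Main.v *)
(** Characters to distinct moduli correlate very little: if [chi], [chi'] are primitive
    modulo [q <> q'], then [chi * conj chi'] is a non-principal character modulo [q q'],
    so all its partial sums are at most [q q' <= x^2].  By duality, if a set of [M] moduli
    carries characters with |sum_{n in P} chi_q(n)| >= W for a multiset [P] in [1, N] of
    multiplicity at most [r], then [M W^2 <= |P| r (N + M x^2)].  No large sieve is
    needed, because one may restrict to [M] of size about [x^0.49] and take [N >= M x^2].

    Apply this to the [nu]-th power of the sum of [chi_q] over the set [A] of integers
    [a <= y] with at most [K = 3 lam lnln y] prime factors, where [nu] is about
    [2.5 ln x / ln y].  A product of [nu] elements of [A] has at most [K nu] prime factors,
    hence arises in at most [nu^(K nu)] ways, and the lower bound on [y] makes this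
    smaller than [x^0.49].

    The integers [a <= y] outside [A] are negligible: with [T = (ln y)^(lam ln 2)], such an
    [a] has at least [T] divisors or a square divisor [s * s] with [s >= T], and there are
    [O(y ln y / T)] of these. *)
Require Import Defs.
From Stdlib Require Import ZArith Reals List Lra Lia Arith Permutation ClassicalEpsilon.
From Coquelicot Require Import Coquelicot.
Import List ListNotations.
Open Scope R_scope.

(** * Finite sums and duality *)

Definition rsum (f : nat -> R) (l : list nat) : R :=
  fold_right (fun a s => f a + s) 0 l.

Definition csum (f : nat -> C) (l : list nat) : C :=
  fold_right (fun a s => Cplus (f a) s) 0%C l.

Lemma rsum_le f g l : (forall a, In a l -> f a <= g a) -> rsum f l <= rsum g l.
Proof.
  induction l as [|a l IH]; simpl; intros H; [lra|].
  apply Rplus_le_compat; auto.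
Qed.

Lemma rsum_ext f g l : (forall a, In a l -> f a = g a) -> rsum f l = rsum g l.
Proof.
  intros H; apply Rle_antisym; apply rsum_le; intros a Ha; rewrite (H a Ha); lra.
Qed.

Lemma rsum_nonneg f l : (forall a, In a l -> 0 <= f a) -> 0 <= rsum f l.
Proof.
  induction l as [|a l IH]; simpl; intros H; [lra|].
  apply Rplus_le_le_0_compat; auto.
Qed.

Lemma rsum_app f l1 l2 : rsum f (l1 ++ l2) = rsum f l1 + rsum f l2.
Proof. induction l1 as [|a l IH]; simpl; [|rewrite IH]; lra. Qed.

Lemma rsum_plus f g l : rsum (fun a => f a + g a) l = rsum f l + rsum g l.
Proof. induction l as [|a l IH]; simpl; [|rewrite IH]; lra. Qed.

Lemma rsum_scal c f l : rsum (fun a => c * f a) l = c * rsum f l.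
Proof. induction l as [|a l IH]; simpl; [|rewrite IH]; lra. Qed.

Lemma rsum_const c l : rsum (fun _ => c) l = INR (length l) * c.
Proof.
  induction l as [|a l IH]; [simpl; lra|].
  change (c + rsum (fun _ => c) l = INR (S (length l)) * c).
  rewrite S_INR, IH; lra.
Qed.

Lemma rsum_swap (f : nat -> nat -> R) l1 l2 :
  rsum (fun a => rsum (f a) l2) l1 = rsum (fun b => rsum (fun a => f a b) l1) l2.
Proof.
  induction l1 as [|a l IH]; simpl.
  - rewrite rsum_const; ring.
  - rewrite IH, <- rsum_plus; reflexivity.
Qed.

Lemma rsum_filter (p : nat -> bool) f l :
  rsum f (filter p l) = rsum (fun a => if p a then f a else 0) l.
Proof.
  induction l as [|a l IH]; simpl; [lra|].
  destruct (p a); simpl; rewrite IH; lra.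
Qed.

Lemma rsum_indicator h a U : NoDup U -> In a U ->
  rsum (fun u => if Nat.eq_dec a u then h u else 0) U = h a.
Proof.
  induction U as [|u U IH]; simpl; intros HU Ha; [tauto|].
  inversion HU as [|? ? Hn HU']; subst.
  destruct (Nat.eq_dec a u) as [->|Hne].
  - rewrite (rsum_ext _ (fun _ => 0)).
    + rewrite rsum_const; ring.
    + intros b Hb; destruct (Nat.eq_dec u b); [subst; tauto|reflexivity].
  - rewrite IH; [lra|assumption|destruct Ha; [congruence|assumption]].
Qed.

(** Grouping the terms of [P] by value turns the sum into one over [U], weighted by the number of
    occurrences. *)
Lemma rsum_multiplicity h P U (r : nat) :
  (forall n, 0 <= h n) -> NoDup U -> incl P U ->
  (forall n, In n U -> (count_occ Nat.eq_dec P n <= r)%nat) ->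
  rsum h P <= INR r * rsum h U.
Proof.
  intros Hh HU HP Hr.
  assert (E : rsum h P = rsum (fun u => INR (count_occ Nat.eq_dec P u) * h u) U).
  { clear Hr; induction P as [|a P IH].
    - simpl. rewrite (rsum_ext _ (fun _ => 0)); [rewrite rsum_const; ring|].
      intros; ring.
    - change (rsum h (a :: P)) with (h a + rsum h P).
      rewrite IH by (intros b Hb; apply HP; right; exact Hb).
      rewrite <- (rsum_indicator h a U HU) at 1 by (apply HP; left; reflexivity).
      rewrite <- rsum_plus; apply rsum_ext; intros u _.
      simpl count_occ; destruct (Nat.eq_dec a u).
      + rewrite S_INR; ring.
      + ring. }
  rewrite E, <- rsum_scal; apply rsum_le; intros u Hu.
  apply Rmult_le_compat_r; [apply Hh|apply le_INR, Hr, Hu].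
Qed.

(** Cauchy-Schwarz against the constant 1, from summing [(f a - t) ^ 2 >= 0] with [t] the mean of
    [f]. *)
Lemma rsum_sqr_le f l : (rsum f l) ^ 2 <= INR (length l) * rsum (fun a => f a ^ 2) l.
Proof.
  destruct l as [|a0 l0]; [simpl; lra|]; set (l := a0 :: l0).
  assert (Hn : 0 < INR (length l)) by (apply lt_0_INR; simpl; lia).
  set (n := INR (length l)) in *; set (s := rsum f l); set (t := s / n).
  assert (H : 2 * t * s <= rsum (fun a => f a ^ 2) l + n * t ^ 2).
  { unfold s, n; rewrite <- rsum_const, <- rsum_plus, <- rsum_scal.
    apply rsum_le; intros a _; pose proof (pow2_ge_0 (f a - t)); nra. }
  assert (Ht : s = n * t) by (unfold t; field; lra).
  rewrite Ht in *; nra.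
Qed.

Lemma csum_ext f g l : (forall a, In a l -> f a = g a) -> csum f l = csum g l.
Proof.
  induction l as [|a l IH]; simpl; intros H; [reflexivity|].
  rewrite IH, H; auto.
Qed.

Lemma csum_app f l1 l2 : csum f (l1 ++ l2) = Cplus (csum f l1) (csum f l2).
Proof. induction l1 as [|a l IH]; simpl; [|rewrite IH]; ring. Qed.

Lemma csum_map f g l : csum f (map g l) = csum (fun a => f (g a)) l.
Proof. induction l as [|a l IH]; simpl; [|rewrite IH]; reflexivity. Qed.

Lemma csum_plus f g l : csum (fun a => Cplus (f a) (g a)) l = Cplus (csum f l) (csum g l).
Proof. induction l as [|a l IH]; simpl; [|rewrite IH]; ring. Qed.

Lemma csum_scal c f l : csum (fun a => Cmult c (f a)) l = Cmult c (csum f l).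
Proof. induction l as [|a l IH]; simpl; [|rewrite IH]; ring. Qed.

Lemma csum_zero l : csum (fun _ => 0%C) l = 0%C.
Proof. induction l as [|a l IH]; simpl; [|rewrite IH]; ring. Qed.

Lemma csum_swap (f : nat -> nat -> C) l1 l2 :
  csum (fun a => csum (f a) l2) l1 = csum (fun b => csum (fun a => f a b) l1) l2.
Proof.
  induction l1 as [|a l IH]; simpl.
  - symmetry; apply csum_zero.
  - rewrite IH, <- csum_plus; reflexivity.
Qed.

Lemma csum_perm f l1 l2 : Permutation l1 l2 -> csum f l1 = csum f l2.
Proof.
  induction 1; simpl; [reflexivity|congruence|ring|congruence].
Qed.

Lemma csum_conj f l : Cconj (csum f l) = csum (fun a => Cconj (f a)) l.
Proof.
  induction l as [|a l IH]; simpl.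
  - apply injective_projections; simpl; ring.
  - rewrite <- IH; apply injective_projections; simpl; ring.
Qed.

Lemma csum_RtoC f l : csum (fun a => RtoC (f a)) l = RtoC (rsum f l).
Proof. induction l as [|a l IH]; simpl; [|rewrite IH, RtoC_plus]; reflexivity. Qed.

Lemma Cmod_csum_le f l : Cmod (csum f l) <= rsum (fun a => Cmod (f a)) l.
Proof.
  induction l as [|a l IH]; simpl; [rewrite Cmod_0; lra|].
  eapply Rle_trans; [apply Cmod_triangle|lra].
Qed.

Lemma Cmult_conj_Cmod z : Cmult z (Cconj z) = RtoC (Cmod z ^ 2).
Proof.
  unfold Cmod; rewrite <- Rsqr_pow2, Rsqr_sqrt by (destruct z; simpl; nra).
  apply injective_projections; destruct z; simpl; ring.
Qed.

(* Duality: testing the hypothesis against unimodular weights turns it into an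
   upper bound for the Gram matrix of the vectors [chi q]. *)
Lemma large_values (chi : nat -> nat -> C) (B P : list nat) (N r : nat) (V D : R) :
  0 < V -> 0 <= D -> NoDup B ->
  (forall q, In q B -> V <= Cmod (csum (chi q) P)) ->
  incl P (seq 1 N) ->
  (forall n, In n (seq 1 N) -> (count_occ Nat.eq_dec P n <= r)%nat) ->
  (forall q n, In q B -> Cmod (chi q n) <= 1) ->
  (forall q q', In q B -> In q' B -> q <> q' ->
     Cmod (csum (fun n => Cmult (chi q n) (Cconj (chi q' n))) (seq 1 N)) <= D) ->
  (INR (length B) * V) ^ 2 <=
    INR (length P) * (INR r * (INR (length B) * INR N + INR (length B) ^ 2 * D)).
Proof.
  intros HV HD HB HS HP Hr Hle Hort.
  set (S := fun q => csum (chi q) P).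
  set (c := fun q => Cdiv (Cconj (S q)) (RtoC (Cmod (S q)))).
  set (g := fun n => csum (fun q => Cmult (c q) (chi q n)) B).
  assert (HSpos : forall q, In q B -> 0 < Cmod (S q)).
  { intros q Hq; apply Rlt_le_trans with V; [lra|apply HS, Hq]. }
  assert (HcS : forall q, In q B -> Cmult (c q) (S q) = RtoC (Cmod (S q))).
  { intros q Hq; pose proof (HSpos q Hq) as H; unfold c, Cdiv.
    transitivity (Cmult (Cmult (S q) (Cconj (S q))) (Cinv (RtoC (Cmod (S q))))); [ring|].
    rewrite Cmult_conj_Cmod, <- RtoC_inv, <- RtoC_mult by lra; f_equal; field; lra. }
  assert (Hc1 : forall q, In q B -> Cmod (c q) = 1).
  { intros q Hq; pose proof (HSpos q Hq) as H.
    unfold c; rewrite Cmod_div, Cmod_conj, Cmod_R, Rabs_pos_eq by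
      (try lra; intros E; apply RtoC_inj in E; lra).
    field; lra. }
  (* The weight [c q] rotates [S q] onto the positive axis, so summing [g] over [P] gives the sum of
     all [Cmod (S q)] without cancellation. *)
  assert (Hlow : INR (length B) * V <= rsum (fun n => Cmod (g n)) P).
  { apply Rle_trans with (rsum (fun q => Cmod (S q)) B).
    - rewrite <- rsum_const; apply rsum_le; intros q Hq; apply HS, Hq.
    - apply Rle_trans with (Cmod (csum g P)); [|apply Cmod_csum_le].
      replace (csum g P) with (RtoC (rsum (fun q => Cmod (S q)) B)).
      + rewrite Cmod_R; apply Rle_abs.
      + rewrite <- csum_RtoC; unfold g; rewrite csum_swap.
        apply csum_ext; intros q Hq; rewrite csum_scal, <- (HcS q Hq); reflexivity. }
  (* Expanding the square gives a double sum over pairs of moduli. A diagonal pair costs at most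
     [N], any other pair at most [D]; allowing [D] on the diagonal too gives the square of
     [length B]. *)
  assert (Hgram : rsum (fun n => Cmod (g n) ^ 2) (seq 1 N) <=
                  INR (length B) * INR N + INR (length B) ^ 2 * D).
  { set (G := fun q q' => csum (fun n => Cmult (chi q n) (Cconj (chi q' n))) (seq 1 N)).
    assert (E : RtoC (rsum (fun n => Cmod (g n) ^ 2) (seq 1 N)) =
        csum (fun q => csum (fun q' =>
          Cmult (Cmult (c q) (Cconj (c q'))) (G q q')) B) B).
    { rewrite <- csum_RtoC.
      rewrite (csum_ext _ (fun n => csum (fun q => csum (fun q' =>
         Cmult (Cmult (c q) (Cconj (c q'))) (Cmult (chi q n) (Cconj (chi q' n)))) B) B)).
      - rewrite csum_swap; apply csum_ext; intros q _.
        rewrite csum_swap; apply csum_ext; intros q' _.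
        rewrite csum_scal; reflexivity.
      - intros n _; rewrite <- Cmult_conj_Cmod.
        unfold g at 2; rewrite csum_conj.
        rewrite <- csum_scal.
        transitivity (csum (fun q' => csum (fun q =>
         Cmult (Cmult (c q) (Cconj (c q'))) (Cmult (chi q n) (Cconj (chi q' n)))) B) B).
        + apply csum_ext; intros q' _.
          rewrite Cmult_comm; unfold g; rewrite <- csum_scal.
          apply csum_ext; intros q _; rewrite Cmult_conj; ring.
        + apply csum_swap. }
    apply Rle_trans with (Cmod (RtoC (rsum (fun n => Cmod (g n) ^ 2) (seq 1 N)))).
    { rewrite Cmod_R; apply Rle_abs. }
    rewrite E.
    eapply Rle_trans; [apply Cmod_csum_le|].
    apply Rle_trans with
      (rsum (fun q => rsum (fun q' => (if Nat.eq_dec q q' then INR N else 0) + D) B) B).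
    - apply rsum_le; intros q Hq.
      eapply Rle_trans; [apply Cmod_csum_le|].
      apply rsum_le; intros q' Hq'.
      rewrite !Cmod_mult, Cmod_conj, !Hc1, !Rmult_1_l by assumption.
      destruct (Nat.eq_dec q q') as [<-|Hne].
      + unfold G; eapply Rle_trans; [apply Cmod_csum_le|].
        apply Rle_trans with (INR N); [|lra].
        rewrite <- (length_seq N 1) at 2.
        rewrite <- (Rmult_1_r (INR (length _))), <- rsum_const.
        apply rsum_le; intros n _; rewrite Cmod_mult, Cmod_conj.
        pose proof (Hle q n Hq); pose proof (Cmod_ge_0 (chi q n)); nra.
      + rewrite Rplus_0_l; apply Hort; assumption.
    - rewrite (rsum_ext _ (fun _ => INR N + INR (length B) * D)).
      + rewrite rsum_const; nra.
      + intros q Hq; rewrite rsum_plus, rsum_const.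
        rewrite (rsum_indicator (fun _ => INR N)) by assumption; reflexivity. }
  assert (HMV : 0 <= INR (length B) * V) by (apply Rmult_le_pos; [apply pos_INR|lra]).
  (* Cauchy-Schwarz over [P], then passage from the multiset [P] to the full interval at the cost of
     [r]. *)
  eapply Rle_trans; [apply pow_incr; split; [exact HMV|exact Hlow]|].
  eapply Rle_trans; [apply rsum_sqr_le|].
  apply Rmult_le_compat_l; [apply pos_INR|].
  eapply Rle_trans.
  - apply rsum_multiplicity with (U := seq 1 N) (r := r); try assumption.
    + intros n; apply pow2_ge_0.
    + apply seq_NoDup.
  - apply Rmult_le_compat_l; [apply pos_INR|exact Hgram].
Qed.

(** * Prime factors and multiplicities of products *)

Open Scope nat_scope.

Definition nat_prime (p : nat) : Prop :=
  1 < p /\ forall d, Nat.divide d p -> d = 1 \/ d = p.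

Definition nprod (l : list nat) : nat := fold_right Nat.mul 1 l.

Lemma nprod_app l1 l2 : nprod (l1 ++ l2) = nprod l1 * nprod l2.
Proof. induction l1 as [|a l IH]; simpl; [|rewrite IH]; lia. Qed.

Lemma nprod_prime_pos l : Forall nat_prime l -> 0 < nprod l.
Proof.
  induction 1 as [|p l [Hp _] _ IH]; simpl; [lia|].
  apply Nat.mul_pos_pos; lia.
Qed.

Lemma prime_factorization n : 0 < n -> exists l, Forall nat_prime l /\ nprod l = n.
Proof.
  induction n as [n IH] using lt_wf_ind; intros Hn.
  destruct (Nat.eq_dec n 1) as [->|H1]; [exists []; auto|].
  destruct (classic (nat_prime n)) as [Hp|Hp].
  - exists [n]; simpl; split; [auto|lia].
  - assert (exists d, Nat.divide d n /\ d <> 1 /\ d <> n) as (d & [e He] & Hd1 & Hdn).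
    { apply NNPP; intros H; apply Hp; split; [lia|].
      intros d Hd; apply NNPP; intros H'; apply H; exists d; tauto. }
    assert (d <> 0 /\ e <> 0 /\ e <> 1) as (Hd0 & He0 & He1)
      by (repeat split; intros ->; lia).
    destruct (IH d) as (l1 & Hl1 & E1); [nia|lia|].
    destruct (IH e) as (l2 & Hl2 & E2); [nia|lia|].
    exists (l1 ++ l2); split; [apply Forall_app; auto|].
    rewrite nprod_app, E1, E2; lia.
Qed.

Lemma prime_coprime p d : nat_prime p -> ~ Nat.divide p d -> Nat.gcd d p = 1.
Proof.
  intros [_ Hp] Hd; destruct (Hp (Nat.gcd d p) (Nat.gcd_divide_r d p)) as [H|H]; auto.
  exfalso; apply Hd; rewrite <- H; apply Nat.gcd_divide_l.
Qed.

Lemma prime_divide_mul p a b :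
  nat_prime p -> Nat.divide p (a * b) -> Nat.divide p a \/ Nat.divide p b.
Proof.
  intros Hp H; destruct (classic (Nat.divide p a)) as [|Ha]; [auto|right].
  apply Nat.gauss with a; [exact H|].
  rewrite Nat.gcd_comm; apply prime_coprime; assumption.
Qed.

Lemma prime_divide_nprod p l :
  nat_prime p -> Forall nat_prime l -> Nat.divide p (nprod l) -> In p l.
Proof.
  intros Hp; induction 1 as [|q l Hq _ IH]; simpl; intros H.
  - apply Nat.divide_1_r in H; destruct Hp; lia.
  - destruct (prime_divide_mul _ _ _ Hp H) as [H'|H']; [|auto].
    destruct (proj2 Hq p H') as [E|E]; [destruct Hp; lia|auto].
Qed.

Definition divisors (n : nat) : list nat :=
  filter (fun d => n mod d =? 0) (seq 1 n).

Lemma in_divisors n d : 0 < n -> In d (divisors n) <-> Nat.divide d n.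
Proof.
  intros Hn; unfold divisors; rewrite filter_In, in_seq, Nat.eqb_eq; split.
  - intros [Hd H]; apply Nat.Lcm0.mod_divide in H; exact H.
  - intros H; pose proof (Nat.divide_pos_le d n Hn H).
    split; [|apply Nat.Lcm0.mod_divide; exact H].
    destruct H as [e He]; nia.
Qed.

Lemma divisors_NoDup n : NoDup (divisors n).
Proof. apply NoDup_filter, seq_NoDup. Qed.

Lemma list_sum_support (f : nat -> nat) l1 l2 :
  NoDup l1 -> (forall a, In a l1 -> f a <> 0 -> In a l2) ->
  list_sum (map f l1) <= list_sum (map f l2).
Proof.
  revert l2; induction l1 as [|a l1 IH]; simpl; intros l2 Hnd H; [lia|].
  inversion Hnd as [|? ? Hn Hnd']; subst.
  destruct (Nat.eq_dec (f a) 0) as [E|E]; [rewrite E; apply IH; auto|].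
  destruct (in_split a l2 (H a (or_introl eq_refl) E)) as (u & v & ->).
  rewrite map_app, list_sum_app; simpl.
  specialize (IH (u ++ v) Hnd'); rewrite map_app, list_sum_app in IH.
  assert (forall b, In b l1 -> f b <> 0 -> In b (u ++ v)); [|specialize (IH H0); lia].
  intros b Hb Hf; specialize (H b (or_intror Hb) Hf).
  rewrite in_app_iff in *; simpl in H; destruct H as [|[->|]]; tauto.
Qed.

Lemma list_sum_le (f g : nat -> nat) l :
  (forall a, In a l -> f a <= g a) -> list_sum (map f l) <= list_sum (map g l).
Proof.
  induction l as [|a l IH]; simpl; intros H; [lia|].
  apply Nat.add_le_mono; auto.
Qed.

Lemma list_sum_mul c (f : nat -> nat) l :
  list_sum (map (fun a => c * f a) l) = c * list_sum (map f l).
Proof. induction l as [|a l IH]; simpl; [|rewrite IH]; lia. Qed.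

(** For [n > 0] this is the [nu]-fold divisor function, with [d] as the first of the [nu]
    factors. *)
Fixpoint ordered_factorizations (nu n : nat) : nat :=
  match nu with
  | O => if n =? 1 then 1 else 0
  | S k => list_sum (map (fun d => ordered_factorizations k (n / d)) (divisors n))
  end.

Lemma divisors_prime_mul p m : nat_prime p -> 0 < m ->
  incl (divisors (p * m)) (divisors m ++ map (Nat.mul p) (divisors m)).
Proof.
  intros Hp Hm d Hd; pose proof (proj1 Hp).
  rewrite in_divisors in Hd by nia; rewrite in_app_iff, in_map_iff.
  destruct (classic (Nat.divide p d)) as [[e He]|Hpd].
  - right; exists e; split; [lia|].
    apply in_divisors; [exact Hm|].
    apply Nat.mul_divide_cancel_l with p; [lia|].
    rewrite (Nat.mul_comm p e), <- He; exact Hd.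
  - left; apply in_divisors; [exact Hm|].
    apply Nat.gauss with p; [exact Hd|apply prime_coprime; assumption].
Qed.

(** The additional prime [p] has to be placed in one of [nu] factors. In the induction, a first
    factor [d] dividing [m] leaves [p] to the others, and a first factor [p * d] absorbs it. *)
Lemma ordered_factorizations_prime_mul nu p m :
  nat_prime p -> 0 < m -> ordered_factorizations nu (p * m) <= nu * ordered_factorizations nu m.
Proof.
  intros Hp; revert m; induction nu as [|nu IH]; intros m Hm; simpl ordered_factorizations.
  - destruct (Nat.eqb_spec (p * m) 1) as [H|H]; [|lia].
    destruct Hp as [Hp _]; nia.
  - eapply Nat.le_trans.
    { apply list_sum_support with (l2 := divisors m ++ map (Nat.mul p) (divisors m)).
      - apply divisors_NoDup.
      - intros d Hd _; apply divisors_prime_mul; assumption. }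
    rewrite map_app, list_sum_app, map_map, Nat.mul_succ_l, <- list_sum_mul.
    pose proof (proj1 Hp) as Hp1.
    apply Nat.add_le_mono; apply list_sum_le; intros d Hd;
      rewrite in_divisors in Hd by exact Hm; destruct Hd as [e ->].
    + assert (0 < d /\ 0 < e) as [Hd He] by nia.
      rewrite Nat.mul_assoc, !Nat.div_mul by lia; apply IH; lia.
    + assert (0 < d /\ 0 < e) as [Hd He] by nia.
      replace (p * (e * d)) with (e * (p * d)) by lia.
      rewrite !Nat.div_mul by nia; lia.
Qed.

Lemma ordered_factorizations_1 nu : ordered_factorizations nu 1 = 1.
Proof. induction nu as [|nu IH]; simpl in *; [reflexivity|rewrite IH; reflexivity]. Qed.

Lemma ordered_factorizations_nprod nu l : Forall nat_prime l ->
  ordered_factorizations nu (nprod l) <= nu ^ length l.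
Proof.
  induction 1 as [|p l Hp Hl IH]; simpl; [rewrite ordered_factorizations_1; lia|].
  eapply Nat.le_trans.
  { apply ordered_factorizations_prime_mul; [exact Hp|apply nprod_prime_pos, Hl]. }
  apply Nat.mul_le_mono_l, IH.
Qed.

(** The divisors of [b] and their multiples by [p] are disjoint families of divisors of [p * b]. *)
Lemma length_divisors_prime_mul p b : nat_prime p -> 0 < b -> ~ Nat.divide p b ->
  2 * length (divisors b) <= length (divisors (p * b)).
Proof.
  intros Hp Hb Hpb; pose proof (proj1 Hp) as Hp1.
  replace (2 * length (divisors b))
    with (length (divisors b ++ map (Nat.mul p) (divisors b)))
    by (rewrite length_app, length_map; lia).
  apply NoDup_incl_length.
  - apply NoDup_app; [apply divisors_NoDup| |].
    + apply NoDup_map_NoDup_ForallPairs; [|apply divisors_NoDup].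
      intros u v _ _ E; nia.
    + intros d Hd; rewrite in_map_iff; intros (e & <- & _).
      rewrite in_divisors in Hd by exact Hb.
      apply Hpb, Nat.divide_trans with (p * e); [apply Nat.divide_factor_l|exact Hd].
  - intros d; rewrite in_app_iff, in_map_iff; intros [Hd|(e & <- & Hd)];
      rewrite in_divisors in Hd by exact Hb; apply in_divisors; try nia.
    + apply Nat.divide_mul_r, Hd.
    + apply Nat.mul_divide_mono_l, Hd.
Qed.

Lemma length_divisors_mono a b : 0 < b -> Nat.divide a b ->
  length (divisors a) <= length (divisors b).
Proof.
  intros Hb Hab; apply NoDup_incl_length; [apply divisors_NoDup|].
  assert (0 < a) by (destruct Hab; nia).
  intros d Hd; rewrite in_divisors in * by assumption.
  apply Nat.divide_trans with a; assumption.
Qed.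

(** Equal primes are paired off into [s]; each prime left unpaired doubles the number of
    divisors. *)
Lemma pow2_length_le l : Forall nat_prime l ->
  exists s, 0 < s /\ Nat.divide (s * s) (nprod l) /\
    2 ^ length l <= length (divisors (nprod l)) * (s * s).
Proof.
  remember (length l) as k eqn:Hk; revert l Hk.
  induction k as [k IH] using lt_wf_ind; intros l -> Hl.
  destruct l as [|p l].
  - exists 1; simpl; repeat split; auto; exists 1; reflexivity.
  - inversion Hl as [|? ? Hp Hl']; subst; pose proof (proj1 Hp) as Hp1.
    pose proof (nprod_prime_pos l Hl') as Hpos.
    destruct (classic (Nat.divide p (nprod l))) as [Hd|Hd].
    (* The prime [p] recurs: both copies are removed and [p] joins [s]. The gain [p * p >= 4] pays
       for the two factors 2 on the left. *)
    + destruct (in_split _ _ (prime_divide_nprod _ _ Hp Hl' Hd)) as (u & v & ->).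
      assert (Huv : Forall nat_prime (u ++ v)).
      { apply Forall_app in Hl' as [Hu Hv]; inversion Hv; subst.
        apply Forall_app; auto. }
      destruct (IH (length (u ++ v))) with (l := u ++ v) as (s & Hs & Hsd & Hle); auto.
      { simpl; rewrite !length_app; simpl; lia. }
      assert (E : nprod (p :: u ++ p :: v) = p * p * nprod (u ++ v)).
      { simpl; rewrite !nprod_app; simpl; lia. }
      rewrite E; exists (p * s); split; [nia|split].
      * replace (p * s * (p * s)) with (p * p * (s * s)) by lia.
        apply Nat.mul_divide_mono_l, Hsd.
      * pose proof (nprod_prime_pos _ Huv).
        assert (length (divisors (nprod (u ++ v))) <=
                length (divisors (p * p * nprod (u ++ v)))).
        { apply length_divisors_mono; [nia|apply Nat.divide_factor_r]. }
        replace (length (p :: u ++ p :: v)) with (S (S (length (u ++ v))))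
          by (simpl; rewrite !length_app; simpl; lia).
        simpl Nat.pow.
        set (D := length (divisors (nprod (u ++ v)))) in *.
        set (D' := length (divisors (p * p * nprod (u ++ v)))) in *.
        apply Nat.le_trans with (4 * (D * (s * s))); [lia|].
        apply Nat.le_trans with ((p * p) * (D' * (s * s))); [|lia].
        apply Nat.mul_le_mono; [nia|]. apply Nat.mul_le_mono_r; assumption.
    + destruct (IH (length l)) with (l := l) as (s & Hs & Hsd & Hle); auto.
      exists s; split; [exact Hs|split].
      * simpl; apply Nat.divide_mul_r, Hsd.
      * pose proof (length_divisors_prime_mul p (nprod l) Hp Hpos Hd).
        simpl nprod; simpl Nat.pow.
        apply Nat.le_trans with (2 * length (divisors (nprod l)) * (s * s)); [lia|].
        apply Nat.mul_le_mono_r; assumption.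
Qed.

(** Repetitions are kept: they record how often a product arises when the [nu]-th power of a sum
    over [A] is expanded. *)
Fixpoint prods (A : list nat) (nu : nat) : list nat :=
  match nu with
  | O => [1]
  | S k => flat_map (fun a => map (Nat.mul a) (prods A k)) A
  end.

Lemma count_occ_flat_map (f : nat -> list nat) A n :
  count_occ Nat.eq_dec (flat_map f A) n =
  list_sum (map (fun a => count_occ Nat.eq_dec (f a) n) A).
Proof.
  induction A as [|a A IH]; simpl; [reflexivity|].
  rewrite count_occ_app, IH; reflexivity.
Qed.

Lemma count_occ_map_mul a P n : 0 < a -> Nat.divide a n ->
  count_occ Nat.eq_dec (map (Nat.mul a) P) n = count_occ Nat.eq_dec P (n / a).
Proof.
  intros Ha [e ->]; rewrite Nat.div_mul by lia.
  induction P as [|b P IH]; simpl; [reflexivity|].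
  rewrite IH; destruct (Nat.eq_dec (a * b) (e * a)), (Nat.eq_dec b e); auto; nia.
Qed.

(** The first factor [a] of a product equal to [n] divides [n], and the remaining factors multiply
    to [n / a]. *)
Lemma count_prods_le_ordered_factorizations A nu n : NoDup A -> Forall (lt 0) A -> 0 < n ->
  count_occ Nat.eq_dec (prods A nu) n <= ordered_factorizations nu n.
Proof.
  intros HA Hpos; revert n; induction nu as [|nu IH]; intros n Hn.
  - cbn [prods ordered_factorizations count_occ].
    destruct (Nat.eq_dec 1 n) as [<-|H]; [reflexivity|apply Nat.le_0_l].
  - simpl; rewrite count_occ_flat_map.
    eapply Nat.le_trans.
    + apply list_sum_support with (l2 := divisors n); [exact HA|].
      intros a Ha H; apply in_divisors; [exact Hn|].
      assert (In n (map (Nat.mul a) (prods A nu))) as Hin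
        by (apply (count_occ_In Nat.eq_dec); lia).
      apply in_map_iff in Hin as (b & <- & _); apply Nat.divide_factor_l.
    + apply list_sum_le; intros d Hd; rewrite in_divisors in Hd by exact Hn.
      assert (0 < d) by (destruct Hd; nia).
      rewrite count_occ_map_mul by assumption.
      apply IH; destruct Hd as [e ->]; rewrite Nat.div_mul by lia; nia.
Qed.

Lemma length_prods A nu : length (prods A nu) = length A ^ nu.
Proof.
  induction nu as [|nu IH]; simpl; [reflexivity|].
  rewrite <- IH; generalize (prods A nu) as P; intros P; clear IH.
  induction A as [|a A IHA]; simpl; [reflexivity|].
  rewrite length_app, length_map, IHA; reflexivity.
Qed.

Lemma prods_range A nu N n : (forall a, In a A -> 0 < a <= N) ->
  In n (prods A nu) -> 0 < n <= N ^ nu.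
Proof.
  intros HA; revert n; induction nu as [|nu IH]; simpl; intros n H; [lia|].
  apply in_flat_map in H as (a & Ha & H).
  apply in_map_iff in H as (b & <- & Hb).
  specialize (HA a Ha); specialize (IH b Hb); split; [nia|].
  apply Nat.mul_le_mono; lia.
Qed.

(** Primes count with multiplicity. Asking only for some short factorization lets factorizations of
    factors be concatenated without appeal to uniqueness. *)
Definition few_primes (K a : nat) : Prop :=
  exists l, Forall nat_prime l /\ nprod l = a /\ length l <= K.

Lemma prods_few_primes A K nu n : (forall a, In a A -> few_primes K a) ->
  In n (prods A nu) -> few_primes (K * nu) n.
Proof.
  intros HA; revert n; induction nu as [|nu IH]; simpl; intros n H.
  - exists []; destruct H as [<-|[]]; simpl; repeat split; [constructor|lia].
  - apply in_flat_map in H as (a & Ha & H).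
    apply in_map_iff in H as (b & <- & Hb).
    destruct (HA a Ha) as (l1 & H1 & E1 & L1), (IH b Hb) as (l2 & H2 & E2 & L2).
    exists (l1 ++ l2); rewrite nprod_app, length_app, E1, E2; repeat split; [|nia].
    apply Forall_app; auto.
Qed.

(** An [n] that occurs at all is a product of at most [K * nu] primes, each of which can lie in any
    of the [nu] factors. *)
Lemma count_prods_le A K nu n : NoDup A -> Forall (lt 0) A -> 0 < nu ->
  (forall a, In a A -> few_primes K a) ->
  count_occ Nat.eq_dec (prods A nu) n <= nu ^ (K * nu).
Proof.
  intros HA Hpos Hnu Hfew.
  destruct (in_dec Nat.eq_dec n (prods A nu)) as [Hin|Hin].
  - destruct (prods_few_primes A K nu n Hfew Hin) as (l & Hl & <- & Hlen).
    eapply Nat.le_trans.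
    { apply count_prods_le_ordered_factorizations; auto using nprod_prime_pos. }
    eapply Nat.le_trans; [apply ordered_factorizations_nprod, Hl|].
    apply Nat.pow_le_mono_r; lia.
  - apply (count_occ_not_In Nat.eq_dec) in Hin; rewrite Hin; lia.
Qed.

Close Scope nat_scope.

(** * Correlations of primitive characters *)

Definition completely_multiplicative (psi : nat -> C) : Prop :=
  forall m n : nat, psi (m * n)%nat = Cmult (psi m) (psi n).

Definition periodic (q : nat) (psi : nat -> C) : Prop :=
  forall n : nat, psi (n + q)%nat = psi n.

Lemma periodic_mul q psi n k : periodic q psi -> psi (n + k * q)%nat = psi n.
Proof.
  intros H; induction k as [|k IH]; simpl; [f_equal; lia|].
  rewrite <- IH, <- (H (n + k * q)%nat); f_equal; lia.
Qed.

Lemma periodic_mod q psi n : periodic q psi -> psi (n mod q)%nat = psi n.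
Proof.
  intros H; rewrite (Nat.div_mod_eq n q) at 2.
  rewrite Nat.add_comm, Nat.mul_comm, periodic_mul; auto.
Qed.

(* A value of modulus larger than 1 would have unbounded powers, while a
   periodic function takes finitely many values. *)
Lemma Cmod_multiplicative_periodic_le_1 q psi n : (0 < q)%nat ->
  completely_multiplicative psi -> periodic q psi -> psi 1%nat = 1%C -> Cmod (psi n) <= 1.
Proof.
  intros Hq Hm Hp H1; apply Rnot_lt_le; intros Hlt.
  set (M := rsum (fun a => Cmod (psi a)) (seq 0 q)).
  assert (HM : forall a, Cmod (psi a) <= M).
  { intros a; rewrite <- (periodic_mod q psi a Hp).
    assert (Hin : In (a mod q)%nat (seq 0 q))
      by (apply in_seq; pose proof (Nat.mod_upper_bound a q); lia).
    unfold M; rewrite <- (rsum_indicator (fun a => Cmod (psi a)) _ _ (seq_NoDup q 0) Hin).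
    apply rsum_le; intros b _; destruct (Nat.eq_dec _ b); [lra|apply Cmod_ge_0]. }
  assert (Hpow : forall k, Cmod (psi (n ^ k)%nat) = Cmod (psi n) ^ k).
  { induction k as [|k IH]; simpl; [rewrite H1; apply Cmod_1|].
    rewrite Hm, Cmod_mult, IH; reflexivity. }
  destruct (Pow_x_infinity (Cmod (psi n))) with (b := M + 1) as [k Hk].
  { rewrite Rabs_pos_eq; [lra|apply Cmod_ge_0]. }
  specialize (Hk k (le_n k)); rewrite <- Hpow, Rabs_pos_eq in Hk by apply Cmod_ge_0.
  specialize (HM (n ^ k)%nat); lra.
Qed.

(** Pigeonhole: [q] distinct residues exhaust all residues modulo [q]. *)
Lemma mod_map_Permutation_seq q (f : nat -> nat) l : length l = q -> NoDup l ->
  (forall a b, In a l -> In b l -> (f a mod q = f b mod q)%nat -> a = b) ->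
  Permutation (map (fun a => f a mod q)%nat l) (seq 0 q).
Proof.
  intros Hl Hnd Hinj; apply NoDup_Permutation_bis.
  - apply NoDup_map_NoDup_ForallPairs; [exact Hinj|exact Hnd].
  - rewrite length_map, length_seq; lia.
  - intros b Hb; apply in_map_iff in Hb as (a & <- & Ha); apply in_seq.
    destruct q as [|q]; [destruct l; [destruct Ha|discriminate]|].
    pose proof (Nat.mod_upper_bound (f a) (S q)); lia.
Qed.

Lemma mod_eq_divide_sub a b q : (a <= b)%nat -> (a mod q = b mod q)%nat ->
  Nat.divide q (b - a).
Proof.
  intros Hab E; exists (b / q - a / q)%nat.
  pose proof (Nat.div_mod_eq a q); pose proof (Nat.div_mod_eq b q).
  rewrite Nat.mul_sub_distr_r; lia.
Qed.

Lemma seq_mod_inj q s a b : In a (seq s q) -> In b (seq s q) ->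
  (a mod q = b mod q)%nat -> a = b.
Proof.
  assert (H : forall a b, In a (seq s q) -> In b (seq s q) -> (a <= b)%nat ->
    (a mod q = b mod q)%nat -> a = b).
  { intros a' b'; rewrite !in_seq; intros Ha Hb Hab E.
    destruct (mod_eq_divide_sub _ _ _ Hab E) as [[|k] Hk]; [lia|nia]. }
  intros Ha Hb E; destruct (Nat.le_ge_cases a b); [|symmetry]; apply H; auto.
Qed.

Lemma mul_mod_inj q u a b : Nat.gcd u q = 1%nat -> In a (seq 0 q) -> In b (seq 0 q) ->
  ((u * a) mod q = (u * b) mod q)%nat -> a = b.
Proof.
  intros Hu.
  assert (H : forall a b, In a (seq 0 q) -> In b (seq 0 q) -> (a <= b)%nat ->
    ((u * a) mod q = (u * b) mod q)%nat -> a = b).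
  { intros a' b'; rewrite !in_seq; intros Ha Hb Hab E.
    apply mod_eq_divide_sub in E; [|nia].
    rewrite <- Nat.mul_sub_distr_l in E.
    apply Nat.gauss in E; [|rewrite Nat.gcd_comm; exact Hu].
    destruct E as [[|k] Hk]; [lia|nia]. }
  intros Ha Hb E; destruct (Nat.le_ge_cases a b); [|symmetry]; apply H; auto.
Qed.

(** A window of [q] consecutive integers meets every residue once, and multiplication by the unit
    [u] permutes the residues. Hence the sum [S] satisfies [S = psi u * S], which forces it to
    vanish. *)
Lemma csum_period q psi u s : (0 < q)%nat ->
  completely_multiplicative psi -> periodic q psi ->
  Nat.gcd u q = 1%nat -> psi u <> 1%C -> csum psi (seq s q) = 0%C.
Proof.
  intros Hq Hm Hp Hu Hne.
  assert (E : csum psi (seq s q) = csum psi (seq 0 q)).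
  { rewrite <- (csum_perm psi _ _ (mod_map_Permutation_seq q (fun a => a) (seq s q)
      (length_seq q s) (seq_NoDup q s) (seq_mod_inj q s))).
    rewrite csum_map; apply csum_ext; intros a _; symmetry; apply periodic_mod, Hp. }
  assert (E' : csum psi (seq 0 q) = Cmult (psi u) (csum psi (seq 0 q))).
  { rewrite <- (csum_perm psi _ _ (mod_map_Permutation_seq q (Nat.mul u) (seq 0 q)
      (length_seq q 0) (seq_NoDup q 0) (fun a b => mul_mod_inj q u a b Hu))) at 1.
    rewrite csum_map, <- csum_scal; apply csum_ext; intros a _.
    rewrite periodic_mod, Hm by exact Hp; reflexivity. }
  rewrite E; set (S := csum psi (seq 0 q)) in *.
  apply NNPP; intros HS; apply Hne.
  transitivity (Cmult (Cmult (psi u) S) (Cinv S)); [field; exact HS|].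
  rewrite <- E'; field; exact HS.
Qed.

(** Full periods cancel; fewer than [q] terms of modulus at most 1 remain. *)
Lemma Cmod_csum_seq_le q psi u s N : (0 < q)%nat ->
  completely_multiplicative psi -> periodic q psi -> psi 1%nat = 1%C ->
  Nat.gcd u q = 1%nat -> psi u <> 1%C -> Cmod (csum psi (seq s N)) <= INR q.
Proof.
  intros Hq Hm Hp H1 Hu Hne; revert s; induction N as [N IH] using lt_wf_ind; intros s.
  destruct (le_lt_dec q N) as [H|H].
  - replace N with (q + (N - q))%nat by lia; rewrite seq_app, csum_app.
    rewrite csum_period with (u := u), Cplus_0_l by assumption.
    apply IH; lia.
  - eapply Rle_trans; [apply Cmod_csum_le|].
    apply Rle_trans with (rsum (fun _ => 1) (seq s N)).
    + apply rsum_le; intros a _; apply Cmod_multiplicative_periodic_le_1 with q; assumption.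
    + rewrite rsum_const, length_seq, Rmult_1_r; apply le_INR; lia.
Qed.

Lemma dirichlet_char_Cmod_le_1 q chi n : (0 < q)%nat -> dirichlet_char q chi ->
  Cmod (chi n) <= 1.
Proof.
  intros Hq (Hm & Hp & _ & H1); apply Cmod_multiplicative_periodic_le_1 with q; assumption.
Qed.

Lemma gcd_add_mul_l n k q : Nat.gcd (n + k * q) q = Nat.gcd n q.
Proof. rewrite Nat.gcd_comm, Nat.gcd_add_mult_diag_r, Nat.gcd_comm; reflexivity. Qed.

Lemma gcd_mul_coprime u a b :
  Nat.gcd u a = 1%nat -> Nat.gcd u b = 1%nat -> Nat.gcd u (a * b) = 1%nat.
Proof.
  intros Ha Hb; set (g := Nat.gcd u (a * b)).
  assert (Hg : Nat.divide g b).
  { apply Nat.gauss with a; [apply Nat.gcd_divide_r|].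
    apply Nat.divide_1_r; rewrite <- Ha; apply Nat.gcd_greatest.
    - apply Nat.divide_trans with g; [apply Nat.gcd_divide_l|apply Nat.gcd_divide_l].
    - apply Nat.gcd_divide_r. }
  apply Nat.divide_1_r; rewrite <- Hb; apply Nat.gcd_greatest; [apply Nat.gcd_divide_l|exact Hg].
Qed.

(** Writing [n = 1 + t * gcd], one multiplies the Bezout identity for the gcd by [t]. The common
    value is 1 modulo [q'] and [n] modulo [q]. *)
Lemma crt_one q q' n : (0 < q')%nat -> (0 < n)%nat ->
  (n mod Nat.gcd q' q = 1 mod Nat.gcd q' q)%nat ->
  exists i j, (1 + j * q' = n + i * q)%nat.
Proof.
  intros Hq' Hn E; destruct (Nat.gcd_bezout_pos q' q Hq') as (u & v & Huv).
  destruct (mod_eq_divide_sub 1 n (Nat.gcd q' q)) as [t Ht]; [lia|congruence|].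
  exists (t * v)%nat, (t * u)%nat.
  replace n with (1 + t * Nat.gcd q' q)%nat by lia.
  rewrite <- Nat.mul_assoc, Huv; lia.
Qed.

(* If the characters agree on everything coprime to both moduli, the Chinese
   remainder theorem makes [chi] trivial on the residues that are 1 modulo the gcd. *)
Lemma induced_modulus_gcd q q' chi chi' : (0 < q)%nat -> (0 < q')%nat ->
  dirichlet_char q chi -> dirichlet_char q' chi' ->
  (forall u, Nat.gcd u (q * q') = 1%nat -> chi u = chi' u) ->
  induced_modulus q (Nat.gcd q' q) chi.
Proof.
  intros Hq Hq' (_ & Hp & _ & _) (_ & Hp' & _ & H1') Heq n Hg Hmod.
  assert (Hpos : forall n, (0 < n)%nat -> Nat.gcd n q = 1%nat ->
    (n mod Nat.gcd q' q = 1 mod Nat.gcd q' q)%nat -> chi n = 1%C).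
  { clear n Hg Hmod; intros n Hn Hg Hmod.
    (* The number [n + i * q = 1 + j * q'] is coprime to both moduli, so there [chi] takes the value
       of [chi'], which is [chi' 1]. *)
    destruct (crt_one q q' n Hq' Hn Hmod) as (i & j & E).
    rewrite <- (periodic_mul q chi n i Hp), <- E, Heq.
    - rewrite periodic_mul by exact Hp'; exact H1'.
    - apply gcd_mul_coprime.
      + rewrite E, gcd_add_mul_l; exact Hg.
      + rewrite gcd_add_mul_l; apply Nat.divide_1_r, Nat.gcd_divide_l. }
  (* Adding [q] makes the argument positive when [n = 0], without changing its class modulo [q] or
     the gcd. *)
  rewrite <- (Hp n); apply Hpos; [lia| |].
  - rewrite <- (Nat.mul_1_l q) at 1; rewrite gcd_add_mul_l; exact Hg.
  - rewrite <- Hmod; destruct (Nat.gcd_divide_r q' q) as [k Hk]; rewrite Hk at 1.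
    apply Nat.Div0.mod_add.
Qed.

(** The product of the moduli is 1, so both equal 1 and [Cconj w] is the inverse of [w]. *)
Lemma Cmult_conj_eq_1 z w : Cmod z <= 1 -> Cmod w <= 1 ->
  Cmult z (Cconj w) = 1%C -> z = w.
Proof.
  intros Hz Hw E.
  assert (Hww : Cmod w = 1).
  { assert (Cmod z * Cmod w = 1) by
      (rewrite <- (Cmod_conj w), <- Cmod_mult, E; apply Cmod_1).
    pose proof (Cmod_ge_0 z); pose proof (Cmod_ge_0 w); nra. }
  transitivity (Cmult z (Cmult w (Cconj w))).
  - rewrite Cmult_conj_Cmod, Hww; simpl.
    replace (1 * (1 * 1)) with 1 by ring; ring.
  - transitivity (Cmult w (Cmult z (Cconj w))); [ring|rewrite E; ring].
Qed.

Lemma primitive_correlation q q' chi chi' N : (0 < q)%nat -> (0 < q')%nat -> q <> q' ->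
  primitive_char q chi -> primitive_char q' chi' ->
  Cmod (csum (fun n => Cmult (chi n) (Cconj (chi' n))) (seq 1 N)) <= INR (q * q').
Proof.
  intros Hq Hq' Hne [Hchi Hprim] [Hchi' Hprim'].
  assert (exists u, Nat.gcd u (q * q') = 1%nat /\
    Cmult (chi u) (Cconj (chi' u)) <> 1%C) as (u & Hu & Hu1).
  (* Were the product character principal, [chi] and [chi'] would agree on all units modulo
     [q * q'], hence both be induced from the gcd. Primitivity then gives [q = gcd = q']. *)
  { apply NNPP; intros Hno.
    assert (Heq : forall u, Nat.gcd u (q * q') = 1%nat -> chi u = chi' u).
    { intros u Hu; apply Cmult_conj_eq_1.
      - apply dirichlet_char_Cmod_le_1 with q; assumption.
      - apply dirichlet_char_Cmod_le_1 with q'; assumption.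
      - apply NNPP; intros H; apply Hno; exists u; tauto. }
    assert (Hg : Nat.gcd q' q = q).
    { apply NNPP; intros H.
      pose proof (Nat.divide_pos_le _ _ Hq (Nat.gcd_divide_r q' q)).
      apply (Hprim (Nat.gcd q' q)); [apply Nat.gcd_divide_r|lia|].
      apply induced_modulus_gcd with chi'; assumption. }
    assert (Hg' : Nat.gcd q q' = q').
    { apply NNPP; intros H.
      pose proof (Nat.divide_pos_le _ _ Hq' (Nat.gcd_divide_r q q')).
      apply (Hprim' (Nat.gcd q q')); [apply Nat.gcd_divide_r|lia|].
      apply induced_modulus_gcd with chi; try assumption.
      intros v Hv; symmetry; apply Heq; rewrite Nat.mul_comm; exact Hv. }
    apply Hne; rewrite Nat.gcd_comm in Hg'; congruence. }
  destruct Hchi as (Hm & Hp & _ & H1), Hchi' as (Hm' & Hp' & _ & H1').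
  apply Cmod_csum_seq_le with u; try assumption.
  - nia.
  - intros m n; rewrite Hm, Hm', Cmult_conj; ring.
  - intros n; rewrite (Nat.mul_comm q q'), (periodic_mul q chi) by exact Hp.
    rewrite (Nat.mul_comm q' q), (periodic_mul q' chi') by exact Hp'; reflexivity.
  - rewrite H1, H1'; apply injective_projections; simpl; ring.
Qed.

Lemma Cmod_csum_prods psi A nu : completely_multiplicative psi -> psi 1%nat = 1%C ->
  Cmod (csum psi (prods A nu)) = Cmod (csum psi A) ^ nu.
Proof.
  intros Hm H1; induction nu as [|nu IH].
  - simpl; rewrite H1, Cplus_0_r; apply Cmod_1.
  - simpl; rewrite <- IH, <- Cmod_mult; f_equal.
    generalize (prods A nu) as P; intros P; clear IH.
    induction A as [|a A IHA]; simpl; [ring|].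
    rewrite csum_app, IHA, csum_map.
    rewrite (csum_ext _ (fun b => Cmult (psi a) (psi b))) by (intros; apply Hm).
    rewrite csum_scal; ring.
Qed.

Lemma charsum_csum chi y : charsum chi y = csum chi (seq 1 (Z.to_nat (Int_part y))).
Proof.
  unfold charsum; generalize (Z.to_nat (Int_part y)) as n.
  induction n as [|n IH]; [apply (sum_n_m_zero (G := C_AbelianMonoid) chi 1 0); lia|].
  rewrite sum_n_Sm, IH by lia.
  rewrite seq_S, csum_app; simpl; rewrite Cplus_0_r; reflexivity.
Qed.

(** * Integers with many prime factors *)

Lemma rsum_seq_S f n : rsum f (seq 1 (S n)) = rsum f (seq 1 n) + f (S n).
Proof. rewrite seq_S, rsum_app; simpl; ring. Qed.

Definition dvd_ind (d a : nat) : R := if (a mod d =? 0)%nat then 1 else 0.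

Lemma dvd_ind_bounds d a : 0 <= dvd_ind d a <= 1.
Proof. unfold dvd_ind; destruct (_ =? 0)%nat; lra. Qed.

Lemma dvd_ind_divide d a : Nat.divide d a -> dvd_ind d a = 1.
Proof.
  intros H; apply Nat.Lcm0.mod_divide in H; unfold dvd_ind; rewrite H; reflexivity.
Qed.

Lemma rsum_dvd_ind_le d n : (0 < d)%nat -> rsum (dvd_ind d) (seq 1 n) <= INR n / INR d.
Proof.
  intros Hd; assert (Hd' : 0 < INR d) by (apply lt_0_INR, Hd).
  replace (rsum (dvd_ind d) (seq 1 n))
    with (INR (length (filter (fun a => a mod d =? 0)%nat (seq 1 n)))).
  2:{ rewrite <- (Rmult_1_r (INR _)), <- rsum_const, rsum_filter; reflexivity. }
  apply Rmult_le_reg_r with (INR d); [exact Hd'|].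
  unfold Rdiv; rewrite Rmult_assoc, Rinv_l, Rmult_1_r, <- mult_INR by lra.
  apply le_INR.
  apply Nat.le_trans with (n / d * d)%nat.
  - apply Nat.mul_le_mono_r.
    replace (n / d)%nat with (length (map (Nat.mul d) (seq 1 (n / d))))
      by (rewrite length_map, length_seq; reflexivity).
    apply NoDup_incl_length; [apply NoDup_filter, seq_NoDup|].
    intros a; rewrite filter_In, in_seq, Nat.eqb_eq, in_map_iff; intros [Ha H].
    apply Nat.Lcm0.mod_divide in H; destruct H as [e ->].
    exists e; split; [lia|]; apply in_seq.
    assert (e <= n / d)%nat by (apply Nat.div_le_lower_bound; lia).
    destruct e; lia.
  - rewrite Nat.mul_comm; apply Nat.Div0.mul_div_le.
Qed.

(** Each step uses [/ (m + 1) <= ln (m + 1) - ln m], which is [ln z <= z - 1] at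
    [z = m / (m + 1)]. *)
Lemma rsum_inv_le n : (0 < n)%nat -> rsum (fun d => / INR d) (seq 1 n) <= 1 + ln (INR n).
Proof.
  induction n as [|n IH]; [lia|intros _].
  destruct n as [|n]; [simpl; rewrite ln_1; lra|].
  rewrite rsum_seq_S; specialize (IH ltac:(lia)).
  set (m := S n) in *; rewrite S_INR.
  assert (Hm : 1 <= INR m) by (apply (le_INR 1); lia).
  assert (H : ln (INR m / (INR m + 1)) <= INR m / (INR m + 1) - 1).
  { assert (Hz : 0 < INR m / (INR m + 1)) by (apply Rdiv_lt_0_compat; lra).
    pose proof (exp_ineq1_le (ln (INR m / (INR m + 1)))) as H0.
    rewrite exp_ln in H0 by exact Hz; lra. }
  unfold Rdiv in H; rewrite ln_mult, ln_Rinv in H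
    by (try apply Rinv_0_lt_compat; lra).
  replace (INR m * / (INR m + 1) - 1) with (- / (INR m + 1)) in H by (field; lra).
  lra.
Qed.

(** Count the pairs [d], [a] with [d] dividing [a] by summing over [a] first; a harmonic sum
    results. *)
Lemma rsum_divisors_le n : (0 < n)%nat ->
  rsum (fun a => INR (length (divisors a))) (seq 1 n) <= INR n * (1 + ln (INR n)).
Proof.
  intros Hn.
  apply Rle_trans with (rsum (fun a => rsum (fun d => dvd_ind d a) (seq 1 n)) (seq 1 n)).
  - apply rsum_le; intros a Ha; apply in_seq in Ha.
    replace n with (a + (n - a))%nat by lia.
    rewrite seq_app, rsum_app.
    assert (0 <= rsum (fun d => dvd_ind d a) (seq (1 + a) (n - a)))
      by (apply rsum_nonneg; intros; apply dvd_ind_bounds).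
    unfold divisors; rewrite <- (Rmult_1_r (INR _)), <- rsum_const, rsum_filter.
    unfold dvd_ind in *; lra.
  - rewrite rsum_swap.
    apply Rle_trans with (rsum (fun d => INR n * / INR d) (seq 1 n)).
    + apply rsum_le; intros d Hd; apply in_seq in Hd.
      apply (rsum_dvd_ind_le d n); lia.
    + rewrite rsum_scal; apply Rmult_le_compat_l; [apply pos_INR|].
      apply rsum_inv_le, Hn.
Qed.

(** The term [- / INR n] makes the induction telescope; the 2 leaves room for the first [s >= T]. *)
Lemma rsum_inv_sqr_tail T n : 0 < T ->
  rsum (fun s => if Rle_dec T (INR s) then / (INR s * INR s) else 0) (seq 1 n) <=
  if Rle_dec T (INR n) then 2 / T - / INR n else 0.
Proof.
  intros HT; induction n as [|n IH].
  - simpl; destruct (Rle_dec T 0); lra.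
  - rewrite rsum_seq_S; rewrite !S_INR.
    pose proof (pos_INR n) as Hn.
    assert (Hn1 : / (INR n + 1) <= 1).
    { rewrite <- Rinv_1; apply Rinv_le_contravar; lra. }
    assert (Hn0 : 0 < / (INR n + 1)) by (apply Rinv_0_lt_compat; lra).
    destruct (Rle_dec T (INR n + 1)) as [H|H].
    + rewrite Rinv_mult.
      destruct (Rle_dec T (INR n)) as [H'|H'].
      * assert (/ INR n - / (INR n + 1) = / INR n * / (INR n + 1)) by (field; lra).
        assert (/ (INR n + 1) <= / INR n) by (apply Rinv_le_contravar; lra).
        nra.
      * assert (/ (INR n + 1) <= / T) by (apply Rinv_le_contravar; lra).
        unfold Rdiv; nra.
    + destruct (Rle_dec T (INR n)); lra.
Qed.

Definition few_primes_list (K n : nat) : list nat :=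
  filter (fun a => if excluded_middle_informative (few_primes K a) then true else false)
    (seq 1 n).

Definition many_primes_list (K n : nat) : list nat :=
  filter (fun a => if excluded_middle_informative (few_primes K a) then false else true)
    (seq 1 n).

(* An integer with more than [K] prime factors has at least [T] divisors or a square
   divisor [s * s] with [s >= T]; the square part is what keeps powers of small primes,
   which have few divisors, under control. *)
Lemma length_many_primes_list_le K n T : (0 < n)%nat -> 1 <= T -> T ^ 3 <= 2 ^ S K ->
  INR (length (many_primes_list K n)) <= INR n * (3 + ln (INR n)) / T.
Proof.
  intros Hn HT HK.
  set (sq := fun s a => if Rle_dec T (INR s) then dvd_ind (s * s) a else 0).
  (* [h] is nonnegative and at least 1 on the integers to be counted, so its sum bounds their
     number. *)
  set (h := fun a => / T * INR (length (divisors a)) + rsum (fun s => sq s a) (seq 1 n)).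
  assert (HT' : 0 < / T) by (apply Rinv_0_lt_compat; lra).
  assert (Hsq : forall s a, 0 <= sq s a).
  { intros s a; unfold sq; destruct (Rle_dec T (INR s)); [apply dvd_ind_bounds|lra]. }
  assert (Hsqs : forall a, 0 <= rsum (fun s => sq s a) (seq 1 n)).
  { intros a; apply rsum_nonneg; intros; apply Hsq. }
  apply Rle_trans with (rsum h (seq 1 n)).
  - rewrite <- (Rmult_1_r (INR (length _))), <- rsum_const.
    unfold many_primes_list; rewrite rsum_filter; apply rsum_le; intros a Ha.
    apply in_seq in Ha; unfold h; specialize (Hsqs a).
    pose proof (pos_INR (length (divisors a))) as Hdiv.
    destruct (excluded_middle_informative (few_primes K a)) as [_|Hfew]; [nra|].
    destruct (prime_factorization a) as (l & Hl & El); [lia|].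
    assert (HlK : (S K <= length l)%nat).
    { apply Nat.nle_gt; intros H; apply Hfew; exists l; auto. }
    destruct (pow2_length_le l Hl) as (s & Hs & Hsd & Hle); rewrite El in *.
    apply le_INR in Hle; rewrite !mult_INR, pow_INR in Hle.
    change (INR 2) with 2 in Hle.
    assert (H3 : T ^ 3 <= INR (length (divisors a)) * (INR s * INR s)).
    { eapply Rle_trans; [exact HK|]; eapply Rle_trans; [|exact Hle].
      apply Rle_pow; [lra|exact HlK]. }
    destruct (Rle_lt_dec T (INR s)) as [HTs|HTs].
    + assert (Hin : In s (seq 1 n)).
      { assert (s * s <= a)%nat by (apply Nat.divide_pos_le; [lia|exact Hsd]).
        assert (s <= s * s)%nat by nia.
        apply in_seq; lia. }
      assert (1 <= rsum (fun s => sq s a) (seq 1 n)); [|nra].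
      apply Rle_trans with (sq s a).
      * unfold sq; destruct (Rle_dec T (INR s)); [|lra].
        rewrite dvd_ind_divide by exact Hsd; lra.
      * rewrite <- (rsum_indicator (fun s => sq s a) _ _ (seq_NoDup n 1) Hin).
        apply rsum_le; intros b _; destruct (Nat.eq_dec s b); [lra|apply Hsq].
    + assert (T <= INR (length (divisors a))).
      { pose proof (pos_INR s); apply Rnot_lt_le; intros Hlt.
        assert (INR s * INR s <= T * T) by nra.
        assert (INR (length (divisors a)) * (INR s * INR s) <=
                INR (length (divisors a)) * (T * T)) by (apply Rmult_le_compat_l; lra).
        assert (INR (length (divisors a)) * (T * T) < T * (T * T))
          by (apply Rmult_lt_compat_r; nra).
        simpl in H3; lra. }
      assert (/ T * T <= / T * INR (length (divisors a))) by (apply Rmult_le_compat_l; lra).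
      rewrite Rinv_l in H0 by lra; lra.
  (* The divisor part contributes [n * (1 + ln n) / T], the square part [2 * n / T]. *)
  - unfold h; rewrite rsum_plus, rsum_scal, rsum_swap.
    pose proof (rsum_divisors_le n Hn) as Hd.
    assert (Ht : rsum (fun s => rsum (fun a => sq s a) (seq 1 n)) (seq 1 n) <= INR n * (2 / T)).
    { apply Rle_trans with (rsum (fun s => INR n *
        (if Rle_dec T (INR s) then / (INR s * INR s) else 0)) (seq 1 n)).
      - apply rsum_le; intros s Hs; apply in_seq in Hs; unfold sq.
        destruct (Rle_dec T (INR s)).
        + rewrite <- mult_INR; apply (rsum_dvd_ind_le (s * s) n); nia.
        + rewrite rsum_const; lra.
      - rewrite rsum_scal; apply Rmult_le_compat_l; [apply pos_INR|].
        eapply Rle_trans; [apply rsum_inv_sqr_tail; lra|].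
        destruct (Rle_dec T (INR n)).
        + assert (0 < / INR n) by (apply Rinv_0_lt_compat, lt_0_INR, Hn); lra.
        + unfold Rdiv; lra. }
    apply Rmult_le_compat_l with (r := / T) in Hd; [|lra].
    unfold Rdiv in *; nra.
Qed.

(** * Choice of parameters and conclusion *)

Lemma csum_few_many chi K n :
  csum chi (seq 1 n) =
  Cplus (csum chi (few_primes_list K n)) (csum chi (many_primes_list K n)).
Proof.
  unfold few_primes_list, many_primes_list; induction (seq 1 n) as [|a l IH]; simpl; [ring|].
  rewrite IH; destruct (excluded_middle_informative (few_primes K a)); simpl; ring.
Qed.

(** Duality applied to the [nu]-th powers, with [D = x ^ 2]. The last hypothesis keeps the
    off-diagonal part within the diagonal bound, whence the factor 2. *)
Lemma large_charsums_few (chi : nat -> nat -> C) (B : list nat) (K n nu : nat) (x y V : R) :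
  NoDup B -> (0 < nu)%nat -> 0 < V -> 0 <= y -> INR n <= y ->
  (forall q, In q B -> (0 < q)%nat /\ INR q <= x /\ primitive_char q (chi q) /\
     V <= Cmod (csum (chi q) (few_primes_list K n))) ->
  INR (length B) * x ^ 2 <= y ^ nu ->
  INR (length B) * V ^ (2 * nu) <= 2 * INR nu ^ (K * nu) * y ^ (2 * nu).
Proof.
  intros HB Hnu HV Hy Hn Hq HBx.
  destruct B as [|q0 B0]; [|set (B := q0 :: B0) in *].
  { simpl length; rewrite Rmult_0_l; repeat apply Rmult_le_pos; try lra;
      apply pow_le; [apply pos_INR|exact Hy]. }
  assert (HM : 0 < INR (length B)) by (apply lt_0_INR; simpl; lia).
  set (A := few_primes_list K n) in *.
  assert (HA : forall a, In a A -> (0 < a <= n)%nat /\ few_primes K a).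
  { intros a Ha; unfold A, few_primes_list in Ha; apply filter_In in Ha as [Ha Hf].
    apply in_seq in Ha; split; [lia|].
    destruct (excluded_middle_informative (few_primes K a)); [assumption|discriminate]. }
  assert (HAnd : NoDup A) by apply NoDup_filter, seq_NoDup.
  assert (HAlen : INR (length A) <= y).
  { eapply Rle_trans; [|exact Hn]; apply le_INR.
    rewrite <- (length_seq n 1); apply NoDup_incl_length; [exact HAnd|].
    intros a Ha; apply HA in Ha; apply in_seq; lia. }
  assert (Hx : 0 <= x).
  { destruct (Hq q0) as (_ & H & _); [left; reflexivity|].
    pose proof (pos_INR q0); lra. }
  pose proof (large_values chi B (prods A nu) (n ^ nu) (nu ^ (K * nu)) (V ^ nu) (x ^ 2)) as H.
  rewrite length_prods in H.
  assert (Hmain : (INR (length B) * V ^ nu) ^ 2 <= INR (length A ^ nu) *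
     (INR (nu ^ (K * nu)) *
       (INR (length B) * INR (n ^ nu) + INR (length B) ^ 2 * x ^ 2))).
  { apply H; clear H; try assumption.
    - apply pow_lt, HV.
    - apply pow_le, Hx.
    - intros q Hin; destruct (Hq q Hin) as (_ & _ & [(Hm & _ & _ & H1) _] & HVq).
      rewrite Cmod_csum_prods by assumption.
      apply pow_incr; split; [lra|exact HVq].
    - intros m Hm; apply prods_range with (N := n) in Hm; [apply in_seq; lia|].
      intros a Ha; apply HA, Ha.
    - intros m _; apply count_prods_le; try assumption; [|intros a Ha; apply HA, Ha].
      apply Forall_forall; intros a Ha; apply HA, Ha.
    - intros q m Hin; destruct (Hq q Hin) as (Hq0 & _ & [Hc _] & _).
      apply dirichlet_char_Cmod_le_1 with q; assumption.
    - intros q q' Hin Hin' Hne.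
      destruct (Hq q Hin) as (Hq0 & Hqx & Hc & _), (Hq q' Hin') as (Hq0' & Hqx' & Hc' & _).
      eapply Rle_trans; [apply (primitive_correlation q q' (chi q) (chi q')); assumption|].
      rewrite mult_INR; replace (x ^ 2) with (x * x) by ring.
      apply Rmult_le_compat; auto using pos_INR. }
  rewrite !pow_INR in Hmain.
  assert (HAp : INR (length A) ^ nu <= y ^ nu) by (apply pow_incr; auto using pos_INR).
  assert (Hnp : INR n ^ nu <= y ^ nu) by (apply pow_incr; auto using pos_INR).
  assert (HA0 : 0 <= INR (length A) ^ nu) by (apply pow_le, pos_INR).
  assert (Hn0 : 0 <= INR n ^ nu) by (apply pow_le, pos_INR).
  rewrite !(Nat.mul_comm 2), (pow_mult V), (pow_mult y).
  set (M := INR (length B)) in *; set (r := INR nu ^ (K * nu)) in *.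
  assert (Hr : 0 <= r) by (apply pow_le, pos_INR).
  set (Y := y ^ nu) in *; set (W := V ^ nu) in *.
  apply Rmult_le_reg_l with M; [exact HM|].
  apply Rle_trans with ((M * W) ^ 2); [right; ring|].
  eapply Rle_trans; [exact Hmain|].
  apply Rle_trans with (Y * (r * (M * Y + M * Y))); [|right; ring].
  apply Rmult_le_compat; try assumption.
  - apply Rmult_le_pos; [exact Hr|].
    pose proof (pow2_ge_0 M); pose proof (pow2_ge_0 x); nra.
  - apply Rmult_le_compat_l; [exact Hr|].
    apply Rplus_le_compat; [apply Rmult_le_compat_l; lra|].
    replace (M ^ 2 * x ^ 2) with (M * (M * x ^ 2)) by ring.
    apply Rmult_le_compat_l; lra.
Qed.

Lemma ln_le_sub_1 z : 0 < z -> ln z <= z - 1.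
Proof.
  intros Hz; pose proof (exp_ineq1_le (ln z)) as H; rewrite exp_ln in H by exact Hz; lra.
Qed.

Lemma ln_nonneg z : 1 <= z -> 0 <= ln z.
Proof. intros H; rewrite <- ln_1; apply ln_le; lra. Qed.

Lemma exp_monotone u v : u <= v -> exp u <= exp v.
Proof. intros [H| ->]; [left; apply exp_increasing, H|lra]. Qed.

Lemma pow_exp_ln z n : 0 < z -> z ^ n = exp (INR n * ln z).
Proof. intros Hz; rewrite <- Rpower_pow by exact Hz; reflexivity. Qed.

(** Threshold for the numerical estimates: [ln (ln x) >= exp 3000] from here on. *)
Definition X0 : R := exp (exp (exp 3000)).

(* [ln Y / Y] decreases for [Y >= e], so the lower bound [Y0] for [Y = ln y] gives
   [lam ln Y / Y <= lam ln Y0 / Y0 ~ 1 / (20 lnln x)]. *)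
Lemma lam_lnln_le lam l Y : 3 <= lam -> exp 3000 <= l ->
  20 * lam * ln (lam * l) * l <= Y -> lam * ln Y * l <= 0.0525 * Y.
Proof.
  intros Hlam Hl HY.
  assert (Hl0 : 3001 <= l) by (pose proof (exp_ineq1_le 3000); lra).
  set (h := ln (lam * l)) in *; set (Y0 := 20 * lam * h * l) in *.
  assert (Hh : 3000 <= h).
  { unfold h; rewrite <- (ln_exp 3000); apply ln_le; [apply exp_pos|nra]. }
  assert (Hll : 9003 <= lam * l) by nra.
  assert (HY0 : lam * l <= Y0) by (unfold Y0; nra).
  (* For [h >= 3000], [ln 20 + ln h] is at most [0.05 * h]. The final constant is
     [0.0525 = 1.05 / 20]. *)
  assert (HlnY0 : ln Y0 <= 1.05 * h).
  { replace Y0 with (20 * (lam * l * h)) by (unfold Y0; ring).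
    rewrite (ln_mult 20), (ln_mult (lam * l)) by nra; fold h.
    assert (ln 20 <= 20 - 1) by (apply ln_le_sub_1; lra).
    assert (ln 100 <= 100 - 1) by (apply ln_le_sub_1; lra).
    assert (ln (h / 100) <= h / 100 - 1) by (apply ln_le_sub_1; lra).
    assert (ln h = ln 100 + ln (h / 100)) by (rewrite <- ln_mult by lra; f_equal; field).
    lra. }
  assert (HlnY0' : 1 <= ln Y0).
  { apply Rle_trans with h; [lra|]; apply ln_le; lra. }
  set (t := Y / Y0).
  assert (Ht : Y = t * Y0) by (unfold t; field; lra).
  assert (Ht1 : 1 <= t).
  { apply Rmult_le_reg_r with Y0; lra. }
  (* From [ln t <= t - 1] and [ln Y0 >= 1] follows [ln t + ln Y0 <= t * ln Y0]. *)
  assert (HlnY : ln Y <= t * (1.05 * h)).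
  { rewrite Ht, ln_mult by lra.
    assert (ln t <= t - 1) by (apply ln_le_sub_1; lra); nra. }
  apply Rle_trans with (lam * (t * (1.05 * h)) * l).
  - apply Rmult_le_compat_r; [lra|]; apply Rmult_le_compat_l; lra.
  - rewrite Ht; unfold Y0; clearbody t h; lra.
Qed.

Lemma parameters x y lam : X0 <= x -> 3 <= lam ->
  exp (20 * lam * ln (lam * ln (ln x)) * ln (ln x)) <= y -> y <= x ->
  1 <= ln y /\ 1 <= Rpower (ln y) (lam * ln 2) /\
  exists K nu : nat, (0 < nu)%nat /\
    Rpower (ln y) (lam * ln 2) ^ 3 <= 2 ^ S K /\
    (Rpower x 0.49 + 1) * x ^ 2 <= y ^ nu /\
    2 * INR nu ^ (K * nu) * Rpower (ln y) (lam * ln 2) ^ (2 * nu) <= Rpower x 0.49.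
Proof.
  intros Hx Hlam Hy Hyx.
  assert (Hx0 : 0 < x) by (apply Rlt_le_trans with X0; [apply exp_pos|exact Hx]).
  assert (Hy0 : 0 < y) by (apply Rlt_le_trans with (2 := Hy); apply exp_pos).
  assert (HL : exp (exp 3000) <= ln x).
  { rewrite <- (ln_exp (exp (exp 3000))); apply ln_le; [apply exp_pos|exact Hx]. }
  assert (Hl : exp 3000 <= ln (ln x)).
  { rewrite <- (ln_exp (exp 3000)); apply ln_le; [apply exp_pos|exact HL]. }
  assert (HY : 20 * lam * ln (lam * ln (ln x)) * ln (ln x) <= ln y).
  { rewrite <- ln_exp at 1; apply ln_le; [apply exp_pos|exact Hy]. }
  pose proof (lam_lnln_le lam (ln (ln x)) (ln y) Hlam Hl HY) as Hkey.
  assert (Hl0 : 3001 <= ln (ln x)) by (pose proof (exp_ineq1_le 3000); lra).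
  assert (HL0 : 3002 <= ln x).
  { pose proof (exp_ineq1_le (exp 3000)); pose proof (exp_ineq1_le 3000); lra. }
  assert (HYL : ln y <= ln x) by (apply ln_le; assumption).
  assert (HY3 : 3 <= ln y).
  { assert (3000 <= ln (lam * ln (ln x))).
    { rewrite <- (ln_exp 3000); apply ln_le; [apply exp_pos|nra]. }
    assert (9000 <= lam * ln (lam * ln (ln x))) by nra. nra. }
  set (L := ln x) in *; set (l := ln L) in *; set (Y := ln y) in *; set (w := ln Y) in *.
  assert (Hw : 0 <= w) by (apply ln_nonneg; lra).
  pose proof (ln_nonneg 2 ltac:(lra)) as Hln2.
  assert (Hln2' : ln 2 <= 1) by (pose proof (ln_le_sub_1 2); lra).
  set (k := lam * w) in *.
  assert (Hk : 0 <= k) by (apply Rmult_le_pos; lra).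
  assert (HT : Rpower Y (lam * ln 2) = exp (k * ln 2)).
  { unfold Rpower, k, w; f_equal; ring. }
  rewrite HT.
  assert (Hx49 : Rpower x 0.49 = exp (0.49 * L)) by reflexivity.
  rewrite Hx49.
  split; [lra|split].
  { pose proof (exp_ineq1_le (k * ln 2)); nra. }
  (* As [T = 2^k], any [K + 1 >= 3 * k] gives [T ^ 3 <= 2 ^ S K]. *)
  destruct (nfloor_ex (3 * k)) as [K [HK1 HK2]]; [lra|].
  assert (Hu : 0 <= 2.5 * L / Y) by (apply Rdiv_le_0_compat; lra).
  (* With [nu = m + 1], [y ^ nu] is at least [x^2.5]; the excess over [x^2.49] absorbs the [+ 1]. *)
  destruct (nfloor_ex (2.5 * L / Y)) as [m [Hm1 Hm2]]; [exact Hu|].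
  assert (Hm : 2.5 * L / Y * Y = 2.5 * L) by (field; lra).
  assert (HnuY1 : 2.5 * L <= INR (S m) * Y) by (rewrite S_INR; nra).
  assert (HnuY2 : INR (S m) * Y <= 2.5 * L + Y) by (rewrite S_INR; nra).
  set (nu := S m) in *.
  assert (Hnu1 : 1 <= INR nu) by (apply (le_INR 1); unfold nu; lia).
  assert (Hlnnu : 0 <= ln (INR nu)) by (apply ln_nonneg, Hnu1).
  (* The left side dominates the logarithm of [nu ^ (K * nu) * T ^ (2 * nu)]; the gap to [0.49 * L]
     absorbs the factor 2. If [Y <= L / 4], then [nu <= L] and [ln nu <= l]; otherwise [nu] is
     bounded. *)
  assert (Hexp : INR nu * k * (3 * ln (INR nu) + 2) <= 0.48 * L).
  { apply Rmult_le_reg_r with l; [lra|].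
    apply Rle_trans with (0.0525 * (2.5 * L + Y) * (3 * ln (INR nu) + 2)).
    - apply Rle_trans with (INR nu * (k * l) * (3 * ln (INR nu) + 2)); [right; ring|].
      apply Rmult_le_compat_r; [lra|].
      apply Rle_trans with (INR nu * (0.0525 * Y)); [|nra].
      apply Rmult_le_compat_l; [lra|exact Hkey].
    - assert (HLl : 3001 * L <= L * l) by nra.
      destruct (Rle_lt_dec Y (L / 4)) as [Hc|Hc].
      + assert (Hnu : ln (INR nu) <= l) by (apply ln_le; nra).
        apply Rle_trans with (0.0525 * (2.75 * L) * (3 * l + 2)).
        * apply Rmult_le_compat; lra.
        * lra.
      + assert (Hnu : INR nu <= 14) by nra.
        assert (ln (INR nu) <= 13) by (pose proof (ln_le_sub_1 (INR nu)); lra).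
        apply Rle_trans with (0.0525 * (3.5 * L) * 41).
        * apply Rmult_le_compat; lra.
        * lra. }
  exists K, nu; split; [unfold nu; lia|split; [|split]].
  - rewrite (pow_exp_ln (exp _)), (pow_exp_ln 2), ln_exp, (S_INR K) by (try apply exp_pos; lra).
    apply exp_monotone; replace (INR 3) with 3 by (simpl; ring).
    rewrite <- Rmult_assoc; apply Rmult_le_compat_r; lra.
  - rewrite !pow_exp_ln by assumption; fold L Y.
    apply Rle_trans with (exp (0.01 * L) * exp (0.49 * L) * exp (INR 2 * L)).
    + apply Rmult_le_compat_r; [left; apply exp_pos|].
      pose proof (exp_ineq1_le (0.01 * L)); pose proof (exp_ineq1_le (0.49 * L)); nra.
    + rewrite <- !exp_plus; apply exp_monotone; change (INR 2) with 2; lra.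
  - rewrite (pow_exp_ln (INR nu)), (pow_exp_ln (exp _)), ln_exp by (try apply exp_pos; lra).
    rewrite <- (exp_ln 2) at 1 by lra.
    rewrite <- !exp_plus; apply exp_monotone; rewrite !mult_INR.
    assert (INR K * (INR nu * ln (INR nu)) <= 3 * k * (INR nu * ln (INR nu)))
      by (apply Rmult_le_compat_r; nra).
    assert (INR nu * k * (2 * ln 2) <= INR nu * k * 2)
      by (apply Rmult_le_compat_l; nra).
    change (INR 2) with 2; nra.
Qed.

(** The integers with many prime factors are estimated trivially, each contributing at most 1. *)
Lemma Cmod_le_csum_few_primes q chi n K T : (0 < q)%nat -> dirichlet_char q chi ->
  (0 < n)%nat -> 1 <= T -> T ^ 3 <= 2 ^ S K ->
  Cmod (csum chi (seq 1 n)) <=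
    Cmod (csum chi (few_primes_list K n)) + INR n * (3 + ln (INR n)) / T.
Proof.
  intros Hq Hchi Hn HT HK; rewrite (csum_few_many chi K n).
  eapply Rle_trans; [apply Cmod_triangle|]; apply Rplus_le_compat_l.
  eapply Rle_trans; [apply Cmod_csum_le|].
  eapply Rle_trans; [|apply length_many_primes_list_le with (K := K); assumption].
  rewrite <- (Rmult_1_r (INR (length _))), <- rsum_const.
  apply rsum_le; intros a _; apply dirichlet_char_Cmod_le_1 with q; assumption.
Qed.

Lemma Int_part_nat y : 0 <= y ->
  INR (Z.to_nat (Int_part y)) <= y < INR (Z.to_nat (Int_part y)) + 1.
Proof.
  intros Hy; destruct (base_Int_part y) as [H1 H2].
  assert (Hz : (0 <= Int_part y)%Z).
  { apply le_IZR; apply Rnot_lt_le; intros H.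
    assert (Int_part y <= -1)%Z by (apply lt_IZR in H; lia).
    apply IZR_le in H0; lra. }
  rewrite INR_IZR_INZ, Z2Nat.id by exact Hz; lra.
Qed.

Theorem theorem1p2 :
  exists C1 C2 : R, 0 < C1 /\ 0 < C2 /\
  forall x y lam : R,
    3 <= x -> 3 <= y ->
    3 <= lam -> lam <= ln y / (ln (ln y)) ^ 2 ->
    exp (20 * lam * ln (lam * ln (ln x)) * ln (ln x)) <= y -> y <= x ->
    exists E : list nat,
      INR (length E) <= C1 * Rpower x 0.49 /\
      forall q : nat, (1 <= q)%nat -> INR q <= x -> ~ In q E ->
      forall chi : nat -> C, primitive_char q chi ->
        Cmod (charsum chi y) <= C2 * (y / Rpower (ln y) (lam * ln 2 - 1)).
Proof.
  (* [X0] lets all moduli be exceptional when [x < X0]. Of the 5, the integers with many prime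
     factors use 4, leaving at least [y / T] for the others. *)
  exists X0, 5.
  assert (HX0 : 1 <= X0).
  { unfold X0; pose proof (exp_ineq1_le (exp (exp 3000))).
    pose proof (exp_pos (exp 3000)); lra. }
  split; [lra|split; [lra|]].
  intros x y lam Hx Hy Hlam _ Hexp Hyx.
  assert (Hx49 : 1 <= Rpower x 0.49).
  { rewrite <- (Rpower_O x) by lra; apply Rle_Rpower; lra. }
  set (N := Z.to_nat (Int_part x)).
  assert (HN : forall q, (1 <= q)%nat -> INR q <= x -> In q (seq 1 N)).
  { intros q Hq Hqx; apply in_seq; split; [exact Hq|].
    apply INR_lt; rewrite plus_INR; pose proof (Int_part_nat x); simpl; fold N in H; lra. }
  destruct (Rlt_le_dec x X0) as [Hsmall|Hlarge].
  { exists (seq 1 N); split.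
    - rewrite length_seq; pose proof (Int_part_nat x); fold N in H; nra.
    - intros q Hq Hqx Hnot; exfalso; apply Hnot, HN; assumption. }
  destruct (parameters x y lam Hlarge Hlam Hexp Hyx)
    as (HY & HT1 & K & nu & Hnu & HK & Hynu & Hfin).
  replace (Rpower (ln y) (lam * ln 2 - 1)) with (Rpower (ln y) (lam * ln 2) / ln y).
  2:{ unfold Rminus; rewrite Rpower_plus, Rpower_Ropp, Rpower_1 by lra; reflexivity. }
  set (T := Rpower (ln y) (lam * ln 2)) in *.
  set (bnd := 5 * (y / (T / ln y))).
  set (n := Z.to_nat (Int_part y)).
  assert (Hny : INR n <= y < INR n + 1) by (apply Int_part_nat; lra).
  assert (Hn : (0 < n)%nat) by (apply INR_lt; simpl; lra).
  set (bad := fun q (chi : nat -> C) => primitive_char q chi /\ bnd < Cmod (charsum chi y)).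
  set (E := filter (fun q =>
    if excluded_middle_informative (exists chi, bad q chi) then true else false) (seq 1 N)).
  exists E; split.
  2:{ intros q Hq Hqx Hnot chi Hchi; apply Rnot_lt_le; intros Hlt; apply Hnot.
      apply filter_In; split; [apply HN; assumption|].
      destruct (excluded_middle_informative (exists chi, bad q chi)) as [|Hno]; [reflexivity|].
      exfalso; apply Hno; exists chi; split; assumption. }
  apply Rle_trans with (Rpower x 0.49); [|nra].
  apply Rnot_lt_le; intros HE.
  (* Only [M + 1] bad moduli are kept: more than [x^0.49], yet few enough for
     [(M + 1) * x ^ 2 <= y ^ nu]. *)
  destruct (nfloor_ex (Rpower x 0.49)) as [M [HM1 HM2]]; [lra|].
  set (B := firstn (S M) E).
  assert (HBlen : length B = S M).
  { apply firstn_length_le.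
    assert (M < length E)%nat by (apply INR_lt; lra); lia. }
  assert (HBnd : NoDup B).
  { apply NoDup_app_remove_r with (skipn (S M) E); unfold B; rewrite firstn_skipn.
    apply NoDup_filter, seq_NoDup. }
  (* One bad character is chosen for each modulus in [B]; the zero function only shows the type
     inhabited. *)
  set (chi := fun q => epsilon (inhabits (fun _ => RtoC 0)) (bad q)).
  assert (Hbadq : forall q, In q B -> (0 < q)%nat /\ INR q <= x /\ bad q (chi q)).
  { intros q Hq.
    assert (HqE : In q E) by (rewrite <- (firstn_skipn (S M) E); apply in_or_app; left; exact Hq).
    apply filter_In in HqE as [HqE Hb].
    apply in_seq in HqE; split; [lia|split].
    - apply Rle_trans with (INR N); [apply le_INR; lia|apply Int_part_nat; lra].
    - destruct (excluded_middle_informative (exists chi, bad q chi)); [|discriminate].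
      apply epsilon_spec; assumption. }
  pose proof (large_charsums_few chi B K n nu x y (y / T)) as Hlv.
  rewrite HBlen, S_INR in Hlv.
  assert (HyT : 0 < y / T) by (apply Rdiv_lt_0_compat; lra).
  assert (Hcount : (INR M + 1) * (y / T) ^ (2 * nu) <=
                   2 * INR nu ^ (K * nu) * y ^ (2 * nu)).
  { apply Hlv; try assumption; [lra|lra| |].
    - intros q Hq; destruct (Hbadq q Hq) as (Hq0 & Hqx & Hprim & Hlt).
      repeat split; try assumption; try apply Hprim.
      rewrite charsum_csum in Hlt; fold n in Hlt.
      pose proof (Cmod_le_csum_few_primes q (chi q) n K T Hq0 (proj1 Hprim) Hn HT1 HK) as Hle.
      assert (Hmany : INR n * (3 + ln (INR n)) / T <= 4 * (y / T * ln y)).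
      { assert (ln (INR n) <= ln y) by (apply ln_le; [apply lt_0_INR, Hn|lra]).
        assert (0 <= ln (INR n)) by (apply ln_nonneg, (le_INR 1); lia).
        replace (4 * (y / T * ln y)) with (y * (4 * ln y) / T) by (field; lra).
        apply Rmult_le_compat_r; [left; apply Rinv_0_lt_compat; lra|].
        apply Rmult_le_compat; try lra; apply pos_INR. }
      assert (Hb : bnd = 5 * (y / T * ln y)) by (unfold bnd; field; lra).
      assert (y / T * 1 <= y / T * ln y) by (apply Rmult_le_compat_l; lra).
      lra.
    - eapply Rle_trans; [|exact Hynu].
      apply Rmult_le_compat_r; [apply pow2_ge_0|lra]. }
  assert (HypT : (y / T) ^ (2 * nu) = y ^ (2 * nu) / T ^ (2 * nu)).
  { unfold Rdiv; rewrite Rpow_mult_distr, pow_inv by lra; reflexivity. }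
  assert (HTp : 0 < T ^ (2 * nu)) by (apply pow_lt; lra).
  assert (Hyp : 0 < y ^ (2 * nu)) by (apply pow_lt; lra).
  rewrite HypT in Hcount.
  (* The right side is at most [x^0.49], which is less than [M + 1]: a contradiction. *)
  assert (INR M + 1 <= 2 * INR nu ^ (K * nu) * T ^ (2 * nu)); [|lra].
  apply Rmult_le_reg_r with (y ^ (2 * nu) / T ^ (2 * nu)).
  { apply Rdiv_lt_0_compat; assumption. }
  eapply Rle_trans; [exact Hcount|right; field; lra].
Qed.
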